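(* Let $\mathcal{F}$ be a finite frieze of positive integers of order $n$, and let $s_1$ be its principal growth coefficient. Then $s_1\in\{-2,0,1\}$. Furthermore, the value of $s_1$ is determined by the order of rotational symmetry of the triangulation of an $n$-gon associated to $\mathcal{F}$ (i.e. finite friezes of positive integers whose associated triangulations have the same order of rotational symmetry have the same value of $s_1$).
   Context: A finite frieze of positive integers of order $n\ge3$ is an array $(m_{i,j})$ indexed by $i\in\mathbb{Z}$, $-2\le j-i\le n-2$, with $m_{i,i-2}=m_{i,i+n-2}=0$, $m_{i,i-1}=m_{i,i+n-3}=1$, with all entries with $-1\le j-i\le n-3$ positive integers, and with $m_{i,j}m_{i+1,j+1}-m_{i,j+1}m_{i+1,j}=1$ whenever all four entries lie in the array. Such a frieze is $n$-periodic ($m_{i+n,j+n}=m_{i,j}$). By Conway and Coxeter it corresponds to a triangulation of a convex $n$-gon: $a_i=m_{i,i}$, $i=1,\dots,n$, is the number of triangles incident with vertex $i$ of the triangulation (vertices taken in anti-clockwise order); this is the associated triangulation. Its order of rotational symmetry is the number of rotations of the regular $n$-gon preserving it. The lattice of the frieze is the unique extension $(m_{i,j})_{i,j\in\mathbb{Z}}$ of the array satisfying $m_{i,j}=-m_{j+2,i-2}$ and $m_{i,j}=-m_{j-n+2,i+n-2}$ for all $i,j\in\mathbb{Z}$ (anti-symmetric mirroring across the rows of zeros). The principal growth coefficient is $s_1:=m_{1,p}-m_{2,p-1}$, where $p$ is the minimal period of the frieze, i.e. the least $p\ge1$ with $m_{i+p,j+p}=m_{i,j}$ for all entries. *)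

(* Defs.v *)
From mathcomp Require Import all_boot all_order all_algebra.
From mathcomp Require Import zify ring.
From Stdlib Require Import Classical.
Set Implicit Arguments.
Unset Strict Implicit.
Unset Printing Implicit Defensive.
Import Order.TTheory GRing.Theory Num.Theory.
Local Open Scope ring_scope.

Definition in_band (n : nat) (i j : int) : bool :=
  (- 2 <= j - i) && (j - i <= n%:Z - 2).

(* An array is a total function on pairs of integers; only its values on
   [in_band n] are meaningful. *)
Record finite_frieze (n : nat) (m : int -> int -> int) : Prop := FiniteFrieze {
  frieze_zero_low : forall i, m i (i - 2) = 0;
  frieze_zero_high : forall i, m i (i + n%:Z - 2) = 0;
  frieze_one_low : forall i, m i (i - 1) = 1;
  frieze_one_high : forall i, m i (i + n%:Z - 3) = 1;
  frieze_pos : forall i j,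
    - 1 <= j - i -> j - i <= n%:Z - 3 -> 0 < m i j;
  frieze_unimodular : forall i j,
    in_band n i j -> in_band n (i + 1) (j + 1) ->
    in_band n i (j + 1) -> in_band n (i + 1) j ->
    m i j * m (i + 1) (j + 1) - m i (j + 1) * m (i + 1) j = 1 }.

Record frieze_lattice (n : nat) (m M : int -> int -> int) : Prop :=
  FriezeLattice {
  lattice_extends : forall i j, in_band n i j -> M i j = m i j;
  lattice_mirror_low : forall i j, M i j = - M (j + 2) (i - 2);
  lattice_mirror_high : forall i j,
    M i j = - M (j - n%:Z + 2) (i + n%:Z - 2) }.

Definition frieze_period (n : nat) (m : int -> int -> int) (p : nat) : Prop :=
  forall i j, in_band n i j -> m (i + p%:Z) (j + p%:Z) = m i j.

Definition minimal_period (n : nat) (m : int -> int -> int) (p : nat) : Prop :=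
  [/\ (1 <= p)%N, frieze_period n m p &
      forall q, (1 <= q)%N -> frieze_period n m q -> (p <= q)%N].

(* [s] is the principal growth coefficient of [m]; it exists and is unique
   for every finite frieze, see [principal_growth_coefficient_unique]. *)
Definition principal_growth_coefficient
    (n : nat) (m : int -> int -> int) (s : int) : Prop :=
  exists (M : int -> int -> int) (p : nat),
    [/\ frieze_lattice n m M, minimal_period n m p &
        s = M 1 p%:Z - M 2 (p%:Z - 1)].

(* The vertices of the convex n-gon are 'I_n, in anti-clockwise order; [ordS]
   is the cyclic successor. Chords and triangles are sets of vertices. *)
Definition polygon_side (n : nat) (e : {set 'I_n}) : bool :=
  [exists x : 'I_n, e == [set x; ordS x]].

Definition polygon_diagonal (n : nat) (e : {set 'I_n}) : bool :=
  (#|e| == 2) && ~~ polygon_side e.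

Definition interleaved (n : nat) (e f : {set 'I_n}) : bool :=
  [exists a : 'I_n, exists b : 'I_n, exists c : 'I_n, exists d : 'I_n,
    [&& (a < b)%N, (b < c)%N, (c < d)%N, e == [set a; c] & f == [set b; d]]].

Definition crossing (n : nat) (e f : {set 'I_n}) : bool :=
  interleaved e f || interleaved f e.

Definition noncrossing_diagonals (n : nat) (T : {set {set 'I_n}}) : bool :=
  [forall e in T, polygon_diagonal e] &&
  [forall e in T, forall f in T, ~~ crossing e f].

Definition triangulation (n : nat) (T : {set {set 'I_n}}) : bool :=
  maxset (@noncrossing_diagonals n) T.

(* In a triangulation of a convex polygon, three vertices pairwise joined by
   sides or chosen diagonals bound a face: any other chord through the interior
   of their triangle would cross one of its edges. *)
Definition triangles (n : nat) (T : {set {set 'I_n}}) : {set {set 'I_n}} :=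
  [set t : {set 'I_n} | (#|t| == 3) &&
    [forall e : {set 'I_n},
      (e \subset t) && (#|e| == 2) ==> polygon_side e || (e \in T)]].

(* The vertex labelled 1, ..., n in the mathematical indexing of the
   quiddity a_i = m_{i,i} is the successor of the ordinal x. *)
Definition associated_triangulation
    (n : nat) (m : int -> int -> int) (T : {set {set 'I_n}}) : Prop :=
  triangulation T /\
  forall x : 'I_n,
    m (x.+1)%:Z (x.+1)%:Z = #|[set t in triangles T | x \in t]|%:Z.

Definition rotate_chord (n k : nat) (e : {set 'I_n}) : {set 'I_n} :=
  [set iter k (@ordS n) x | x in e].

Definition rotational_symmetry_order (n : nat) (T : {set {set 'I_n}}) : nat :=
  #|[set k : 'I_n | [set rotate_chord k e | e in T] == T]|.

Section WellDefined.
Variables (n : nat) (m : int -> int -> int).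
Hypothesis n_ge3 : (3 <= n)%N.
Hypothesis mF : finite_frieze n m.

(* The two mirrorings compose to the translation (i, j) |-> (i - n, j + n). *)
Let lattice_fun (i j : int) : int :=
  let q := ((j - i + 2) %/ (2 * n%:Z))%Z in
  if j - i + 2 - q * (2 * n%:Z) <= n%:Z then m (i + q * n%:Z) (j - q * n%:Z)
  else - m (j - q * n%:Z - n%:Z + 2) (i + q * n%:Z + n%:Z - 2).

Let lattice_funE (q i j : int) :
  0 <= j - i + 2 - q * (2 * n%:Z) < 2 * n%:Z ->
  lattice_fun i j =
    if j - i + 2 - q * (2 * n%:Z) <= n%:Z then m (i + q * n%:Z) (j - q * n%:Z)
    else - m (j - q * n%:Z - n%:Z + 2) (i + q * n%:Z + n%:Z - 2).
Proof.
move=> H; rewrite /lattice_fun.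
suff -> : ((j - i + 2) %/ (2 * n%:Z))%Z = q by [].
have -> : j - i + 2 = q * (2 * n%:Z) + (j - i + 2 - q * (2 * n%:Z)) by ring.
rewrite divzMDl; last by lia.
by rewrite divz_small ?addr0 //; move: H; lia.
Qed.

Let quot (i j : int) :
  exists q : int, 0 <= j - i + 2 - q * (2 * n%:Z) < 2 * n%:Z.
Proof.
exists ((j - i + 2) %/ (2 * n%:Z))%Z.
have n0 : 2 * n%:Z != 0 :> int by lia.
have := divz_eq (j - i + 2) (2 * n%:Z).
have := modz_ge0 (j - i + 2) n0.
have : ((j - i + 2) %% (2 * n%:Z))%Z < 2 * n%:Z by rewrite ltz_pmod //; lia.
lia.
Qed.

Let m_low (i j : int) : j = i - 2 -> m i j = 0.
Proof. by move=> ->; apply: (frieze_zero_low mF). Qed.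

Let m_high (i j : int) : j = i + n%:Z - 2 -> m i j = 0.
Proof. by move=> ->; apply: (frieze_zero_high mF). Qed.

Let m_eq i j i' j' : i = i' -> j = j' -> m i j = m i' j'.
Proof. by move=> -> ->. Qed.

Lemma frieze_lattice_exists : exists M, frieze_lattice n m M.
Proof.
exists lattice_fun; split=> i j.
- rewrite /in_band => ij; rewrite (@lattice_funE 0); last by lia.
  by rewrite ifT; [apply: m_eq; lia | lia].
- have [q Hq] := quot i j; rewrite (lattice_funE Hq).
  have [r0|r0] := eqVneq (j - i + 2 - q * (2 * n%:Z)) 0.
    rewrite (@lattice_funE (- q)); last by lia.
    by rewrite !ifT ?m_low ?oppr0 //; lia.
  rewrite (@lattice_funE (- q - 1)); last by lia.
  have [rn|rn|rn] /= := ltgtP (j - i + 2 - q * (2 * n%:Z)) n%:Z.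
  + by rewrite ifF ?opprK; [apply: m_eq; lia | lia].
  + by rewrite ifT; [congr (- _); apply: m_eq; lia | lia].
  + by rewrite ifT ?m_high ?oppr0 //; lia.
- have [q Hq] := quot i j; rewrite (lattice_funE Hq).
  have [r0|r0] := eqVneq (j - i + 2 - q * (2 * n%:Z)) 0.
    rewrite (@lattice_funE (- q + 1)); last by lia.
    by rewrite !ifT ?m_low ?oppr0 //; lia.
  rewrite (@lattice_funE (- q)); last by lia.
  have [rn|rn|rn] /= := ltgtP (j - i + 2 - q * (2 * n%:Z)) n%:Z.
  + by rewrite ifF ?opprK; [apply: m_eq; lia | lia].
  + by rewrite ifT; [congr (- _); apply: m_eq; lia | lia].
  + by rewrite ifT ?m_high ?oppr0 //; lia.
Qed.

Let lattice_shift M : frieze_lattice n m M ->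
  forall i j, M i j = M (i + n%:Z) (j - n%:Z).
Proof.
move=> MF i j; rewrite (lattice_mirror_high MF) (lattice_mirror_low MF) opprK.
by congr (M _ _); lia.
Qed.

Let lattice_shift_nat M : frieze_lattice n m M ->
  forall (k : nat) i j, M i j = M (i + k%:Z * n%:Z) (j - k%:Z * n%:Z).
Proof.
move=> MF; elim=> [|k IH] i j; first by congr (M _ _); lia.
by rewrite IH (lattice_shift MF); congr (M _ _); lia.
Qed.

Let lattice_shift_int M : frieze_lattice n m M ->
  forall (q : int) i j, M i j = M (i + q * n%:Z) (j - q * n%:Z).
Proof.
move=> MF [k|k] i j; first exact: lattice_shift_nat.
rewrite [RHS](lattice_shift_nat MF k.+1) NegzE.
by congr (M _ _); lia.
Qed.

Lemma frieze_lattice_unique M M' : frieze_lattice n m M ->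
  frieze_lattice n m M' -> forall i j, M i j = M' i j.
Proof.
move=> MF MF' i j; have [q Hq] := quot i j.
rewrite (lattice_shift_int MF q) (lattice_shift_int MF' q).
have [rn|rn] := leP (j - i + 2 - q * (2 * n%:Z)) n%:Z.
  by rewrite (lattice_extends MF) ?(lattice_extends MF') // /in_band; lia.
rewrite (lattice_mirror_high MF) (lattice_mirror_high MF').
by rewrite (lattice_extends MF) ?(lattice_extends MF') // /in_band; lia.
Qed.

Let m_one (i j : int) : j = i - 1 -> m i j = 1.
Proof. by move=> ->; apply: (frieze_one_low mF). Qed.

Let m_one_high (i j : int) : j = i + n%:Z - 3 -> m i j = 1.
Proof. by move=> ->; apply: (frieze_one_high mF). Qed.

(* Row recurrence: m_{i,j-1} + m_{i,j+1} = a_{j+1} m_{i,j}. *)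
Let row_rec (d : nat) (i j : int) : j = i - 1 + d%:Z -> d%:Z <= n%:Z - 2 ->
  m i (j - 1) + m i (j + 1) = m (j + 1) (j + 1) * m i j.
Proof.
elim: d i j => [|d IH] i j ij dn.
  have ij' : j = i - 1 by lia.
  rewrite m_low ?(m_one ij') ?add0r ?mulr1; last by lia.
  by apply: m_eq; lia.
have IH' : m (i + 1) (j - 1) + m (i + 1) (j + 1) =
           m (j + 1) (j + 1) * m (i + 1) j by apply: IH; lia.
have W1 : m i j * m (i + 1) (j + 1) - m i (j + 1) * m (i + 1) j = 1.
  by apply: (frieze_unimodular mF); rewrite /in_band; lia.
have W2 : m i (j - 1) * m (i + 1) j - m i j * m (i + 1) (j - 1) = 1.
  have := @frieze_unimodular _ _ mF i (j - 1); rewrite !subrK; apply;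
  by rewrite /in_band; lia.
have pos : m (i + 1) j != 0.
  by apply: lt0r_neq0; apply: (frieze_pos mF); lia.
apply: (mulIf pos); rewrite -mulrA [m i j * _]mulrC mulrA -IH'.
by move: W1 W2; lia.
Qed.

(* Column recurrence: m_{i-1,j} + m_{i+1,j} = a_{i-1} m_{i,j}. *)
Let col_rec (d : nat) (i j : int) : j = i - 1 + d%:Z -> d%:Z <= n%:Z - 2 ->
  m (i - 1) j + m (i + 1) j = m (i - 1) (i - 1) * m i j.
Proof.
elim: d i j => [|d IH] i j ij dn.
  have -> : j = i - 1 by lia.
  by rewrite (@m_low (i + 1)) ?(@m_one i) ?addr0 ?mulr1 //; lia.
have IH' : m (i - 1) (j - 1) + m (i + 1) (j - 1) =
           m (i - 1) (i - 1) * m i (j - 1) by apply: IH; lia.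
have W1 : m (i - 1) (j - 1) * m i j - m (i - 1) j * m i (j - 1) = 1.
  have := @frieze_unimodular _ _ mF (i - 1) (j - 1); rewrite !subrK; apply;
  by rewrite /in_band; lia.
have W2 : m i (j - 1) * m (i + 1) j - m i j * m (i + 1) (j - 1) = 1.
  have := @frieze_unimodular _ _ mF i (j - 1); rewrite !subrK; apply;
  by rewrite /in_band; lia.
have pos : m i (j - 1) != 0.
  by apply: lt0r_neq0; apply: (frieze_pos mF); lia.
apply: (mulIf pos); rewrite -mulrA [m i j * _]mulrC mulrA -IH'.
by move: W1 W2; lia.
Qed.

Let quiddity_period (i : int) : m (i + n%:Z) (i + n%:Z) = m i i.
Proof.
have H1 := @row_rec n.-2 (i + 2) (i + n%:Z - 1).
have H2 := @col_rec n.-2 (i + 1) (i + n%:Z - 2).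
have {H1} : m (i + 2) (i + n%:Z - 2) = m (i + n%:Z) (i + n%:Z).
  have {}H1 := H1 ltac:(lia) ltac:(lia).
  rewrite (@m_high (i + 2) (i + n%:Z - 1 + 1)) in H1; last by lia.
  rewrite (@m_one_high (i + 2) (i + n%:Z - 1)) in H1; last by lia.
  rewrite addr0 mulr1 in H1.
  transitivity (m (i + 2) (i + n%:Z - 1 - 1)); first by apply: m_eq; lia.
  by rewrite H1; apply: m_eq; lia.
move=> <-.
have {}H2 := H2 ltac:(lia) ltac:(lia).
rewrite (@m_high (i + 1 - 1)) in H2; last by lia.
rewrite (@m_one_high (i + 1)) in H2; last by lia.
rewrite add0r mulr1 addrK in H2.
by rewrite -H2; apply: m_eq; lia.
Qed.

Lemma finite_frieze_period : frieze_period n m n.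
Proof.
have H : forall d : nat,
  (d%:Z <= n%:Z -> forall i : int,
     m (i + n%:Z) (i + n%:Z - 2 + d%:Z) = m i (i - 2 + d%:Z)) /\
  (d.+1%:Z <= n%:Z -> forall i : int,
     m (i + n%:Z) (i + n%:Z - 2 + d.+1%:Z) = m i (i - 2 + d.+1%:Z)).
  elim=> [|d [IH1 IH2]].
    by split=> dn i; [rewrite !m_low | rewrite !m_one]; lia.
  split=> // dn i.
  have R1 := @row_rec d i (i - 1 + d%:Z) erefl ltac:(lia).
  have R2 := @row_rec d (i + n%:Z) (i + n%:Z - 1 + d%:Z) erefl ltac:(lia).
  have E1 := IH1 ltac:(lia) i.
  have E2 := IH2 ltac:(lia) i.
  have Q := quiddity_period (i + d%:Z).
  have -> : m (i + n%:Z) (i + n%:Z - 2 + d.+2%:Z) =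
            m (i + n%:Z) (i + n%:Z - 1 + d%:Z + 1) by apply: m_eq; lia.
  have -> : m i (i - 2 + d.+2%:Z) = m i (i - 1 + d%:Z + 1).
    by apply: m_eq; lia.
  apply: (addrI (m i (i - 1 + d%:Z - 1))); rewrite R1.
  have -> : m i (i - 1 + d%:Z - 1) =
            m (i + n%:Z) (i + n%:Z - 1 + d%:Z - 1).
    transitivity (m i (i - 2 + d%:Z)); first by apply: m_eq; lia.
    by rewrite -E1; apply: m_eq; lia.
  rewrite R2; congr (_ * _).
    transitivity (m (i + d%:Z + n%:Z) (i + d%:Z + n%:Z)).
      by apply: m_eq; lia.
    by rewrite Q; apply: m_eq; lia.
  transitivity (m (i + n%:Z) (i + n%:Z - 2 + d.+1%:Z)).
    by apply: m_eq; lia.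
  by rewrite E2; apply: m_eq; lia.
move=> i j; rewrite /in_band => ij.
have E : (absz (j - i + 2))%:Z = j - i + 2 by lia.
have [Hd _] := H (absz (j - i + 2)).
have {}Hd := Hd ltac:(lia) i; rewrite E in Hd.
transitivity (m (i + n%:Z) (i + n%:Z - 2 + (j - i + 2))).
  by apply: m_eq; lia.
by rewrite Hd; apply: m_eq; lia.
Qed.

Lemma minimal_period_exists : exists p, minimal_period n m p.
Proof.
suff H : forall k q : nat, (q <= k)%N -> (1 <= q)%N -> frieze_period n m q ->
    exists p, minimal_period n m p.
  by apply: (H n n (leqnn n)); [lia | apply: finite_frieze_period].
elim=> [|k IH] q qk q1 qP; first by lia.
case: (classic (exists q', [/\ (1 <= q')%N, (q' < q)%N & frieze_period n m q'])).
  by move=> [q' [q'1 q'q q'P]]; apply: (IH q') => //; lia.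
move=> nq; exists q; split=> // q' q'1 q'P; rewrite leqNgt; apply/negP => q'q.
by apply: nq; exists q'.
Qed.

Lemma principal_growth_coefficient_unique :
  exists! s, principal_growth_coefficient n m s.
Proof.
have [M MF] := frieze_lattice_exists.
have [p pP] := minimal_period_exists.
exists (M 1 p%:Z - M 2 (p%:Z - 1)); split; first by exists M, p.
move=> s [M' [p' [MF' pP' ->]]].
have -> : p' = p.
  case: pP pP' => [p1 pp pmin] [p'1 pp' p'min].
  by apply/eqP; rewrite eqn_leq pmin // p'min.
by rewrite !(frieze_lattice_unique MF MF').
Qed.

End WellDefined.

(* Main.v *)
Require Import Defs.
From mathcomp Require Import all_boot all_order all_algebra.
From mathcomp Require Import zify ring.
Set Implicit Arguments.
Unset Strict Implicit.
Unset Printing Implicit Defensive.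
Import Order.TTheory GRing.Theory Num.Theory.
Local Open Scope ring_scope.

(** Let p be the minimal period and n = r p. The entries of row 1 solve the
    p-periodic recurrence u_{k+1} = a_k u_k - u_{k-1}, whose monodromy over one
    period has determinant 1 and trace s = s_1. By Cayley-Hamilton the entries
    at distance multiples of p satisfy U_{j+2} = s U_{j+1} - U_j with U_0 = 0,
    U_j > 0 for 0 < j < r and U_r = 0. Since s >= 2 makes U increasing, this
    forces r = 2 and s = 0, or r = 3 and s = 1; for r = 1 the mirroring gives
    s = -2. So s is a function of r = n / p.

    It remains to identify r with the order of rotational symmetry. Cutting off
    triangles shows that each diagonal of the triangulation carries a frieze
    entry 1, and by the Ptolemy relation chords with entry 1 do not cross, so by
    maximality the triangulation is the set of all diagonals with entry 1. Hence
    the rotations preserving it are the periods of the frieze. *)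

(** * Solutions of the discrete Hill equation and their minors *)

(* The discrete Hill equation: solutions of u_{k+2} = a_k u_{k+1} - u_k. *)
Fixpoint hill (a : nat -> int) (x y : int) (k : nat) : int :=
  match k with
  | 0 => x
  | k1.+1 => match k1 with
             | 0 => y
             | k2.+1 => a k2 * hill a x y k1 - hill a x y k2
             end
  end.

Lemma hillSS a x y k :
  hill a x y k.+2 = a k * hill a x y k.+1 - hill a x y k.
Proof. by []. Qed.

Lemma hill_unique (a u : nat -> int) N :
  (forall k, (k.+2 <= N)%N -> u k.+2 = a k * u k.+1 - u k) ->
  forall k, (k <= N)%N -> u k = hill a (u 0%N) (u 1%N) k.
Proof.
move=> uP k; suff: ((k <= N)%N -> u k = hill a (u 0%N) (u 1%N) k) /\
  ((k.+1 <= N)%N -> u k.+1 = hill a (u 0%N) (u 1%N) k.+1) by case.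
elim: k => [|k [IH1 IH2]]; split=> // kN.
by rewrite uP // hillSS IH1 ?IH2 //; lia.
Qed.

(** Starting the second basis solution at -1, 0 rather than 1, 0 makes the two basis solutions the
    rows [lambda a 0] and [lambda a 1]. *)
Lemma hill_linear a x y k :
  hill a x y k = y * hill a 0 1 k - x * hill a (-1) 0 k.
Proof.
rewrite (@hill_unique a
  (fun k => y * hill a 0 1 k - x * hill a (-1) 0 k) k) //=.
  by congr hill; ring.
by move=> l _; ring.
Qed.

Lemma hill_add a x y k l :
  hill a x y (k + l) =
  hill (fun i => a (i + l)%N) (hill a x y l) (hill a x y l.+1) k.
Proof.
by rewrite (@hill_unique (fun i => a (i + l)%N)
  (fun k => hill a x y (k + l)) k).
Qed.

Lemma eq_hill a b x y k : a =1 b -> hill a x y k = hill b x y k.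
Proof.
move=> ab; apply: (@hill_unique b (hill a x y) k) => // l _.
by rewrite hillSS ab.
Qed.

(* For a = quiddity m this is the frieze entry m_{j+1,k-1}, attached to the
   chord joining the vertices labelled j and k. *)
Definition lambda (a : nat -> int) (j k : nat) : int :=
  hill a 0 1 j * hill a (-1) 0 k - hill a 0 1 k * hill a (-1) 0 j.

Lemma lambdaC a j k : lambda a k j = - lambda a j k.
Proof. rewrite /lambda; ring. Qed.

Lemma lambdaxx a j : lambda a j j = 0.
Proof. rewrite /lambda; ring. Qed.

Lemma lambda_rec a j k : lambda a j k.+2 = a k * lambda a j k.+1 - lambda a j k.
Proof. rewrite /lambda !hillSS; ring. Qed.

Lemma lambdaS a j : lambda a j j.+1 = 1.
Proof.
elim: j => [|j IH]; first by rewrite /lambda /=; ring.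
by rewrite lambda_rec lambdaxx lambdaC IH; ring.
Qed.

Lemma lambdaSS a j : lambda a j j.+2 = a j.
Proof. by rewrite lambda_rec lambdaS lambdaxx mulr1 subr0. Qed.

Lemma lambda_hill a j d :
  lambda a j (d + j) = hill (fun i => a (i + j)%N) 0 1 d.
Proof.
rewrite (@hill_unique (fun i => a (i + j)%N)
  (fun d => lambda a j (d + j)) d) //.
  by rewrite add0n add1n lambdaxx lambdaS.
by move=> k _; rewrite !addSn lambda_rec.
Qed.

(** The values of [lambda] are the 2 x 2 minors of the matrix whose rows are the two basis
    solutions; this is their Plucker relation, which plays the role of Ptolemy's relation for
    chords. *)
Lemma lambda_plucker a i j k l :
  lambda a i k * lambda a j l =
  lambda a i j * lambda a k l + lambda a i l * lambda a j k.
Proof. rewrite /lambda; ring. Qed.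

Lemma lambda_period a p j k : (forall i, a (i + p)%N = a i) ->
  lambda a (j + p) (k + p) = lambda a j k.
Proof.
move=> ap; wlog jk : j k / (j <= k)%N.
  move=> H; case: (leqP j k) => [/H//|/ltnW/H E].
  by rewrite lambdaC E -lambdaC.
rewrite -(subnK jk) -addnA !lambda_hill.
by apply: eq_hill => i; rewrite addnA ap.
Qed.

(** Let F and G be the solutions starting at 0, 1 and at -1, 0. The monodromy over one period has
    trace F_{p+1} - G_p, and its determinant is the minor [lambda a p p.+1], which is 1. *)
Lemma hill_cayley_hamilton a p k : (forall i, a (i + p)%N = a i) ->
  hill a 0 1 (k + p + p) =
  (hill a 0 1 p.+1 - hill a (-1) 0 p) * hill a 0 1 (k + p) - hill a 0 1 k.
Proof.
move=> ap.
have shift x y l : hill a x y (l + p) =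
    hill a x y p.+1 * hill a 0 1 l - hill a x y p * hill a (-1) 0 l.
  by rewrite hill_add -hill_linear; apply: eq_hill.
have := lambdaS a p; rewrite /lambda shift [hill a (-1) 0 (k + p)]shift.
move=> W; rewrite [hill a 0 1 (k + p)]shift.
set A := hill a 0 1 p.+1 in W *; set B := hill a 0 1 p in W *.
set C := hill a (-1) 0 p.+1 in W *; set E := hill a (-1) 0 p in W *.
by rewrite -[X in _ = _ - X]mul1r -W; ring.
Qed.

(** * Frieze entries as solutions of the Hill equation *)

Definition quiddity (m : int -> int -> int) (k : nat) : int :=
  m k.+1%:Z k.+1%:Z.

Lemma frieze_eq (m : int -> int -> int) i j i' j' :
  i = i' -> j = j' -> m i j = m i' j'.
Proof. by move=> -> ->. Qed.

(** Induction on the distance from the border: two neighbouring diamonds share m_{i+1,j}, and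
    cancelling this positive entry carries the recurrence from row i+1 to row i. *)
Lemma frieze_row_rec n m : (3 <= n)%N -> finite_frieze n m ->
  forall (d : nat) (i : int), (d.+2 <= n)%N ->
  m i (i + d%:Z) =
    m (i + d%:Z) (i + d%:Z) * m i (i - 1 + d%:Z) - m i (i - 2 + d%:Z).
Proof.
move=> n3 mF; elim=> [|d IH] i dn.
  rewrite !addr0 (frieze_one_low mF) (frieze_zero_low mF) mulr1 subr0 //.
set j := i + d%:Z.
have -> : i + d.+1%:Z = j + 1 by lia.
have -> : i - 1 + d.+1%:Z = j by lia.
have -> : i - 2 + d.+1%:Z = j - 1 by lia.
have {}IH : m (i + 1) (j + 1) =
    m (j + 1) (j + 1) * m (i + 1) j - m (i + 1) (j - 1).
  transitivity (m (i + 1) (i + 1 + d%:Z)); first by apply: frieze_eq; lia.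
  rewrite IH; last by lia.
  by congr (_ * _ - _); apply: frieze_eq; lia.
have W1 : m i j * m (i + 1) (j + 1) - m i (j + 1) * m (i + 1) j = 1.
  by apply: (frieze_unimodular mF); rewrite /in_band; lia.
have W2 : m i (j - 1) * m (i + 1) j - m i j * m (i + 1) (j - 1) = 1.
  have := @frieze_unimodular _ _ mF i (j - 1); rewrite !subrK; apply;
  by rewrite /in_band; lia.
have pos : m (i + 1) j != 0.
  by apply: lt0r_neq0; apply: (frieze_pos mF); lia.
by apply: (mulIf pos); move: W1 W2; rewrite IH; lia.
Qed.

Lemma frieze_row n m : (3 <= n)%N -> finite_frieze n m ->
  forall (i : int) (d : nat), (d <= n)%N ->
  m i (i - 2 + d%:Z) = hill (fun k => m (i + k%:Z) (i + k%:Z)) 0 1 d.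
Proof.
move=> n3 mF i d dn.
rewrite (@hill_unique (fun k => m (i + k%:Z) (i + k%:Z))
  (fun d : nat => m i (i - 2 + d%:Z)) n) //.
  congr hill; first by rewrite addr0 (frieze_zero_low mF).
  by rewrite -[RHS](frieze_one_low mF i); apply: frieze_eq; lia.
move=> k kn.
have -> : i - 2 + k.+2%:Z = i + k%:Z by lia.
by rewrite (frieze_row_rec n3 mF) //; congr (_ * m _ _ - _); lia.
Qed.

Lemma frieze_lambda n m : (3 <= n)%N -> finite_frieze n m ->
  forall (j k : nat), (j <= k)%N -> (k <= j + n)%N ->
  lambda (quiddity m) j k = m (j%:Z + 1) (k%:Z - 1).
Proof.
move=> n3 mF j k jk kn; rewrite -(subnK jk) lambda_hill.
transitivity (m (j%:Z + 1) (j%:Z + 1 - 2 + (k - j)%N%:Z));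
  last by apply: frieze_eq; lia.
rewrite (frieze_row n3 mF); last by lia.
by apply: eq_hill => i; rewrite /quiddity; apply: frieze_eq; lia.
Qed.

Lemma frieze_lambda_pos n m : (3 <= n)%N -> finite_frieze n m ->
  forall (j k : nat), (j < k)%N -> (k < j + n)%N ->
  0 < lambda (quiddity m) j k.
Proof.
move=> n3 mF j k jk kn; rewrite (frieze_lambda n3 mF); try lia.
by apply: (frieze_pos mF); lia.
Qed.

(** * Periods of a frieze *)

Lemma quiddity_period n m p : (3 <= n)%N -> frieze_period n m p ->
  forall i, quiddity m (i + p) = quiddity m i.
Proof.
move=> n3 mp i; rewrite /quiddity -[RHS]mp; last by rewrite /in_band; lia.
by apply: frieze_eq; lia.
Qed.

Lemma period_muln n m p c : frieze_period n m p -> frieze_period n m (c * p).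
Proof.
move=> mp; elim: c => [|c IH] i j ij; first by rewrite mul0n !addr0.
rewrite -(IH i j ij) -(mp (i + (c * p)%N%:Z)); first by apply: frieze_eq; lia.
by move: ij; rewrite /in_band; lia.
Qed.

Lemma period_modn n m p q : frieze_period n m p -> frieze_period n m q ->
  frieze_period n m (q %% p).
Proof.
move=> mp mq i j ij.
rewrite -(mq i j ij) -(period_muln (q %/ p) mp (i := i + _)).
  by apply: frieze_eq; rewrite [X in _ = _ + X%:Z](divn_eq q p); lia.
by move: ij; rewrite /in_band; lia.
Qed.

Lemma minimal_period_dvd n m p : minimal_period n m p ->
  forall q, frieze_period n m q -> (p %| q)%N.
Proof.
case=> p1 mp pmin q mq; rewrite /dvdn; apply/eqP.
case: (posnP (q %% p)) => // qp.
by have := pmin _ qp (period_modn mp mq); rewrite leqNgt ltn_mod p1.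
Qed.

(** * The growth coefficient as a function of n / p *)

Lemma growth_by_symmetry n m p M : (3 <= n)%N -> finite_frieze n m ->
  minimal_period n m p -> frieze_lattice n m M ->
  let s := M 1 p%:Z - M 2 (p%:Z - 1) in
  [\/ n = p /\ s = -2, n = (2 * p)%N /\ s = 0 | n = (3 * p)%N /\ s = 1].
Proof.
move=> n3 mF pP MF s.
have [p1 mp _] := pP.
have /dvdnP[r nE] := minimal_period_dvd pP (finite_frieze_period n3 mF).
have [r1|r1] : r = 1%N \/ (2 <= r)%N by nia.
  (* M_{1,n} lies just outside the band and mirrors to -M_{2,n-1}, so s = -2 m_{2,n-1}, where
     m_{2,n-1} = 1 is a border entry. *)
  constructor 1; have np : n = p by lia.
  split=> //; rewrite /s (lattice_mirror_high MF 1) -np.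
  have -> : n%:Z - n%:Z + 2 = 2 by lia.
  have -> : 1 + n%:Z - 2 = n%:Z - 1 by lia.
  rewrite !(lattice_extends MF) /in_band; try lia.
  have -> : n%:Z - 1 = 2 + n%:Z - 3 by lia.
  by rewrite (frieze_one_high mF).
(* As p < n, both entries defining s lie in the band, and s is the trace of the monodromy. *)
have sE : s = hill (quiddity m) 0 1 p.+1 - hill (quiddity m) (-1) 0 p.
  have pn : (p < n)%N by nia.
  rewrite /s !(lattice_extends MF) /in_band; try lia.
  have := frieze_lambda n3 mF (leq0n p.+1) (pn : (p.+1 <= 0 + n)%N).
  have := @frieze_lambda n m n3 mF 1 p p1 ltac:(lia).
  rewrite /lambda !(mul0r, mulr0, mul1r, subr0, sub0r, mulrN1, opprK) => -> ->.
  by congr (m _ _ - m _ _); lia.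
pose U j := hill (quiddity m) 0 1 (j * p).
have UE j : (j <= r)%N -> U j = m 1 ((j * p)%N%:Z - 1).
  move=> jr; have jn : (j * p <= 0 + n)%N by nia.
  rewrite -(frieze_lambda n3 mF (leq0n _) jn).
  by rewrite /lambda !(mul0r, sub0r, mulrN1, opprK).
have Upos j : (0 < j)%N -> (j < r)%N -> 0 < U j.
  by move=> j0 jr; rewrite UE; [apply: (frieze_pos mF); nia | lia].
have Ur : U r = 0.
  by rewrite UE // -nE -[RHS](frieze_zero_high mF 1); apply: frieze_eq; lia.
have Urec j : U j.+2 = s * U j.+1 - U j.
  have := hill_cayley_hamilton (j * p) (quiddity_period n3 mp).
  by rewrite /U sE -!addnA addnn -mul2n -mulnDl addn2 -mulSnr.
have U0 : U 0%N = 0 by [].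
have U1 : 0 < U 1%N by apply: Upos.
have U2 := Urec 0%N; rewrite U0 subr0 in U2.
have [r2|r2] : r = 2%N \/ (3 <= r)%N by lia.
  constructor 2; split; first by lia.
  by move: Ur U2; rewrite r2 => ->; nia.
have s1 : 1 <= s by have := Upos 2%N isT r2; nia.
have [r3|r3] : r = 3%N \/ (4 <= r)%N by lia.
  constructor 3; split; first by lia.
  have := Urec 1%N; move: Ur; rewrite r3 U2 => -> E.
  suff /eqP : s * s == 1 by nia.
  by apply/eqP/(mulIf (lt0r_neq0 U1)); move: E; lia.
(* For s = 1 the recurrence gives U_3 = U_2 - U_1 = 0, against positivity when r >= 4. *)
have s2 : 2 <= s.
  suff : s != 1 by lia.
  apply/eqP => E; have := Upos 3%N isT r3; rewrite Urec U2 E; lia.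
(* With s >= 2 the sequence is strictly increasing, which contradicts U_r = 0. *)
suff H j : 0 <= U j /\ U j < U j.+1
  by have [] := H r.-1; rewrite prednK ?Ur; lia.
elim: j => [|j [IH1 IH2]]; first by rewrite U0.
rewrite Urec; nia.
Qed.

(** * Arcs of a triangulation *)

Definition arc n (T : {set {set 'I_n}}) (x y : 'I_n) : bool :=
  polygon_side [set x; y] || ([set x; y] \in T).

Lemma arcC n (T : {set {set 'I_n}}) x y : arc T x y = arc T y x.
Proof. by rewrite /arc setUC. Qed.

Lemma set2_ltn_inj n (x y z w : 'I_n) : (x < y)%N -> (z < w)%N ->
  [set x; y] = [set z; w] -> x = z /\ y = w.
Proof.
move=> xy zw E.
have /set2P[xz|xw] : x \in [set z; w] by rewrite -E set21.
  have /set2P[yz|yw] : y \in [set z; w] by rewrite -E set22.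
    by move: xy; rewrite xz yz ltnn.
  by [].
have /set2P[yz|yw] : y \in [set z; w] by rewrite -E set22.
  by move: xy; rewrite xw yz; lia.
by move: xy; rewrite xw yw ltnn.
Qed.

Lemma polygon_side_ltn n (x y : 'I_n) : (x < y)%N ->
  polygon_side [set x; y] =
  (y == x.+1 :> nat) || ((x == 0 :> nat) && (y.+1 == n)).
Proof.
move=> xy; have yn := ltn_ord y.
apply/existsP/orP => [[z /eqP E]|].
  have : x \in [set z; ordS z] by rewrite -E set21.
  have : y \in [set z; ordS z] by rewrite -E set22.
  rewrite !inE => /orP[/eqP yz|/eqP yz] /orP[/eqP xz|/eqP xz].
  - by move: xy; rewrite yz xz ltnn.
  - right; have /= := congr1 val xz; rewrite -yz.
    have [->|yn1] := eqVneq y.+1 n; first by rewrite modnn => ->; rewrite eqxx.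
    by rewrite modn_small; lia.
  - left; have /= := congr1 val yz; rewrite -xz modn_small; last by lia.
    by move=> ->.
  - by move: xy; rewrite yz xz ltnn.
case=> [/eqP yE|/andP[/eqP x0 /eqP yE]].
  exists x; apply/eqP; congr [set _; _]; apply: val_inj.
  by rewrite /= modn_small ?yE //; lia.
exists y; rewrite setUC; apply/eqP; congr [set _; _]; apply: val_inj.
by rewrite /= yE modnn.
Qed.

Lemma arcs_noncrossing n (T : {set {set 'I_n}}) (x y z w : 'I_n) :
  noncrossing_diagonals T -> arc T x z -> arc T y w ->
  (x < y)%N -> (y < z)%N -> (z < w)%N -> False.
Proof.
move=> /andP[_ /forall_inP ncT] xz yw ltxy ltyz ltzw.
have := ltn_ord w; move: xz yw; rewrite /arc !polygon_side_ltn; try lia.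
move=> /orP[|xzT]; first by lia.
move=> /orP[|ywT]; first by lia.
move=> _; have /forall_inP/(_ _ ywT) := ncT _ xzT.
rewrite /crossing /interleaved; case/norP => /negP nI _; apply: nI.
apply/existsP; exists x; apply/existsP; exists y.
apply/existsP; exists z; apply/existsP; exists w.
by rewrite ltxy ltyz ltzw !eqxx.
Qed.

Lemma crossing_irrefl n (e : {set 'I_n}) : ~~ crossing e e.
Proof.
rewrite /crossing orbb; apply/existsP.
move=> -[a] /existsP[b] /existsP[c] /existsP[d].
case/and5P=> ab bc cd /eqP -> /eqP E.
by have [abE _] := set2_ltn_inj (ltn_trans ab bc) (ltn_trans bc cd) E;
  move: ab; rewrite abE ltnn.
Qed.

Lemma crossingC n (e f : {set 'I_n}) : crossing e f = crossing f e.
Proof. by rewrite /crossing orbC. Qed.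

Lemma triangulation_maximal n (T : {set {set 'I_n}}) e :
  triangulation T -> polygon_diagonal e ->
  (forall f, f \in T -> ~~ crossing e f) -> e \in T.
Proof.
move=> /maxsetP[/andP[/forall_inP dT /forall_inP ncT] maxT] de nce.
suff /maxT <- : noncrossing_diagonals (e |: T).
- by rewrite setU11.
- exact: subsetUr.
apply/andP; split; first by apply/forall_inP => f /setU1P[->|/dT].
apply/forall_inP => f /setU1P[->|fT]; apply/forall_inP => g /setU1P[->|gT].
- exact: crossing_irrefl.
- exact: nce.
- by rewrite crossingC nce.
- by have /forall_inP/(_ _ gT) := ncT _ fT.
Qed.

(* The apex is the last vertex before [y] joined to [x]: a diagonal of [T]
   crossing the chord from there to [y] would have to start at [x] and end
   further on. *)
Lemma arc_apex n (T : {set {set 'I_n}}) (x y : 'I_n) :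
  triangulation T -> (x.+1 < y)%N -> arc T x y ->
  exists k : 'I_n, [/\ (x < k)%N, (k < y)%N, arc T x k & arc T k y].
Proof.
move=> trT xy axy; have ncT : noncrossing_diagonals T by case/maxsetP: trT.
have x1n : (x.+1 < n)%N by apply: leq_trans (ltn_ord y); lia.
pose P (k : 'I_n) := [&& (x < k)%N, (k < y)%N & arc T x k].
have P0 : P (Ordinal x1n).
  by rewrite /P /= leqnn xy /arc polygon_side_ltn ?eqxx /=.
case: (arg_maxnP (fun k : 'I_n => k : nat) P0) => k /and3P[xk ky axk] kmax.
exists k; split=> //; apply: contraT; rewrite negb_or => /andP[nside nT].
case/negP: nT; apply: triangulation_maximal => //.
  by rewrite /polygon_diagonal cards2 nside andbT neq_ltn ky.
move=> f fT; apply/negP.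
move=> /orP[] /existsP[a] /existsP[b] /existsP[c] /existsP[d].
  case/and5P=> ab bc cd /eqP E /eqP fE.
  have [ka yc] := set2_ltn_inj ky (ltn_trans ab bc) E; subst a c.
  have abd : arc T b d by rewrite /arc -fE fT orbT.
  by apply: (arcs_noncrossing ncT axy abd) => //; lia.
case/and5P=> ab bc cd /eqP fE /eqP E.
have [kb yd] := set2_ltn_inj ky (ltn_trans bc cd) E; subst b d.
have aac : arc T a c by rewrite /arc -fE fT orbT.
have [ax|xa|/val_inj ax] := ltngtP (a : nat) (x : nat).
- by apply: (arcs_noncrossing ncT aac axy) => //; lia.
- by apply: (arcs_noncrossing ncT axk aac) => //; lia.
- subst a; have : P c by rewrite /P aac cd andbT; lia.
  by move/kmax; lia.
Qed.

(** * Triangle counts in the polygon cut off by an arc *)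

Lemma trianglesP n (T : {set {set 'I_n}}) (t : {set 'I_n}) :
  reflect (#|t| = 3 /\ {in t &, forall x y, x != y -> arc T x y})
          (t \in triangles T).
Proof.
rewrite inE; apply: (iffP andP) => -[/eqP t3 H]; split=> //.
- move=> x y xt yt xy; have := forallP H [set x; y].
  rewrite cards2 xy eqxx andbT.
  by move/implyP; apply; apply/subsetP => z /set2P[] ->.
- apply/forallP => e; apply/implyP => /andP[et /cards2P[x [y [xy eE]]]].
  by rewrite eE; apply: H => //; apply: (subsetP et);
    rewrite eE !inE eqxx ?orbT.
Qed.

Definition vertices_between n (x y : 'I_n) : {set 'I_n} :=
  [set z : 'I_n | (x <= z <= y)%N].

(** When x < y are joined by an arc, this is the quiddity at z of the triangulated polygon with
    vertices x, ..., y. *)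
Definition triangles_between n (T : {set {set 'I_n}}) (x y z : 'I_n) : nat :=
  #|[set t in triangles T | (z \in t) && (t \subset vertices_between x y)]|.

Lemma triangles_betweenE n (T : {set {set 'I_n}}) (x y z : 'I_n) :
  triangles_between T x y z =
  (\sum_(t in triangles T) ((z \in t) && (t \subset vertices_between x y)))%N.
Proof.
rewrite /triangles_between -sum1_card big_mkcond [RHS]big_mkcond.
by apply: eq_bigr => t _; rewrite in_set;
  case: (t \in triangles T) => //=; case: (_ && _).
Qed.

Lemma triangles_between_out n (T : {set {set 'I_n}}) (x y z : 'I_n) :
  z \notin vertices_between x y -> triangles_between T x y z = 0%N.
Proof.
move=> zxy; apply/eqP; rewrite cards_eq0; apply/eqP/setP => t; rewrite !inE.
apply/negP => /and3P[_ zt /subsetP tS]; by rewrite tS in zxy.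
Qed.

Lemma triangles_between_side n (T : {set {set 'I_n}}) (x y z : 'I_n) :
  y = x.+1 :> nat -> triangles_between T x y z = 0%N.
Proof.
move=> yE; apply/eqP; rewrite cards_eq0; apply/eqP/setP => t.
rewrite in_set in_set0.
apply/negP => /and3P[/trianglesP[t3 _] _ tS].
have : (#|t| <= #|[set x; y]|)%N.
  apply: subset_leq_card; apply: subset_trans tS _; apply/subsetP => w.
  rewrite !inE -!val_eqE /=; lia.
by rewrite t3 cards2; case: eqP.
Qed.

Lemma cards3_ltn n (x k y : 'I_n) : (x < k)%N -> (k < y)%N ->
  #|[set x; k; y]| = 3%N.
Proof.
move=> xk ky; rewrite -setUA cardsU1 cards2 !inE -!val_eqE /=.
by rewrite (ltn_eqF xk) (ltn_eqF ky) (ltn_eqF (ltn_trans xk ky)).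
Qed.

(** If t has vertices on both sides of k, a vertex strictly between x and k would send an edge
    across the arc xk, and likewise beyond k for ky; so t can only use x, k and y. *)
Lemma triangle_between_cases n (T : {set {set 'I_n}}) (x k y : 'I_n)
    (t : {set 'I_n}) :
  noncrossing_diagonals T -> (x < k)%N -> (k < y)%N ->
  arc T x k -> arc T k y -> t \in triangles T ->
  t \subset vertices_between x y ->
  [|| t \subset vertices_between x k, t \subset vertices_between k y |
      t == [set x; k; y]].
Proof.
move=> ncT xk ky axk aky /trianglesP[t3 tarc] /subsetP tS.
have txy u : u \in t -> (x <= u <= y)%N by move/tS; rewrite inE.
case: (boolP (t \subset _)) => //= /subsetPn[z zt zk].
case: (boolP (t \subset _)) => //= /subsetPn[w wt wk].
have {}zk : (k < z)%N by have := txy _ zt; move: zk; rewrite inE; lia.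
have {}wk : (w < k)%N by have := txy _ wt; move: wk; rewrite inE; lia.
have left u : u \in t -> (u < k)%N -> u = x.
  move=> ut uk; apply: val_inj; have /andP[+ _] := txy _ ut.
  rewrite leq_eqVlt => /orP[/eqP //|xu]; exfalso.
  by apply: (arcs_noncrossing ncT axk (tarc u z ut zt _)) => //;
    rewrite -val_eqE /=; lia.
have right u : u \in t -> (k < u)%N -> u = y.
  move=> ut ku; apply: val_inj; have /andP[_ +] := txy _ ut.
  rewrite leq_eqVlt => /orP[/eqP //|uy]; exfalso.
  by apply: (arcs_noncrossing ncT (tarc w u wt ut _) aky) => //;
    rewrite -val_eqE /=; lia.
rewrite eqEcard t3 (cards3_ltn xk ky) leqnn andbT; apply/subsetP => u ut.
rewrite !inE; have := ltngtP (u : nat) (k : nat).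
by case=> [/(left _ ut)->|/(right _ ut)->|/val_inj->]; rewrite eqxx ?orbT.
Qed.

(** The three cases for a triangle exclude each other, as the two smaller vertex ranges share only
    k. *)
Lemma triangles_between_split n (T : {set {set 'I_n}}) (x k y z : 'I_n) :
  noncrossing_diagonals T -> (x < k)%N -> (k < y)%N ->
  arc T x k -> arc T k y -> arc T x y ->
  triangles_between T x y z =
  (triangles_between T x k z + triangles_between T k y z +
   (z \in [set x; k; y]))%N.
Proof.
move=> ncT xk ky axk aky axy; rewrite !triangles_betweenE.
set t0 := [set x; k; y].
have t0T : t0 \in triangles T.
  apply/trianglesP; split; first exact: cards3_ltn.
  move=> u v; rewrite !inE => /orP[/orP[]|] /eqP-> /orP[/orP[]|] /eqP->;
    first [by rewrite eqxx | by [] | by rewrite arcC].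
have -> : (z \in t0 : nat) =
    (\sum_(t in triangles T) ((z \in t) && (t == t0)))%N.
  rewrite (bigD1 t0) //= eqxx andbT big1 ?addn0 // => t /andP[_ /negPf->].
  by rewrite andbF.
rewrite -!big_split /=; apply: eq_bigr => t tT.
case: (boolP (z \in t)) => //= zt.
have sub1 : vertices_between x k \subset vertices_between x y.
  by apply/subsetP => u; rewrite !inE; lia.
have sub2 : vertices_between k y \subset vertices_between x y.
  by apply/subsetP => u; rewrite !inE; lia.
have sub0 : t0 \subset vertices_between x y.
  by apply/subsetP => u; rewrite !inE => /orP[/orP[]|] /eqP->; lia.
have n01 : ~~ (t0 \subset vertices_between x k).
  by apply/subsetPn; exists y; rewrite !inE ?eqxx ?orbT //; lia.
have n02 : ~~ (t0 \subset vertices_between k y).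
  by apply/subsetPn; exists x; rewrite !inE ?eqxx ?orbT //; lia.
have n12 : ~~ ((t \subset vertices_between x k) &&
    (t \subset vertices_between k y)).
  rewrite -subsetI; apply/negP => tk.
  have : (#|t| <= #|[set k]|)%N.
    apply: subset_leq_card; apply: subset_trans tk _; apply/subsetP => u.
    by rewrite !inE -val_eqE /=; lia.
  by case/trianglesP: tT => -> _; rewrite cards1.
case: (boolP (t \subset vertices_between x y)) => txy.
  have := triangle_between_cases ncT xk ky axk aky tT txy.
  case: eqP => [->|_]; first by rewrite (negPf n01) (negPf n02).
  by move: n12; do 2!case: (_ \subset _).
case: eqP => [tt0|_]; first by rewrite tt0 sub0 in txy.
case: (boolP (t \subset vertices_between x k)) => [/subset_trans/(_ sub1) t1|_].
  by rewrite t1 in txy.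
case: (boolP (t \subset vertices_between k y)) => //.
move=> /subset_trans/(_ sub2) t1; by rewrite t1 in txy.
Qed.

(** An edge from k to a vertex outside the range would cross the arc xy. *)
Lemma triangles_between_arc n (T : {set {set 'I_n}}) (x k y : 'I_n) :
  noncrossing_diagonals T -> (x < k)%N -> (k < y)%N -> arc T x y ->
  triangles_between T x y k = #|[set t in triangles T | k \in t]|.
Proof.
move=> ncT xk ky axy; apply: eq_card => t; rewrite in_set [RHS]in_set.
apply: andb_id2l => /trianglesP[_ tarc].
case: (boolP (k \in t)) => //= kt; apply/subsetP => u ut; rewrite inE.
rewrite leqNgt [(u <= y)%N]leqNgt; apply/andP; split; apply/negP => lt.
  by apply: (arcs_noncrossing ncT (tarc u k ut kt _) axy);
    rewrite // -val_eqE /=; lia.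
by apply: (arcs_noncrossing ncT axy (tarc k u kt ut _));
  rewrite // -val_eqE /=; lia.
Qed.

(** * Arcs carry the value 1 *)

(** Two polygons are glued to the triangle labelled i, k+1, j+1; d and c stand for their triangle
    counts at the apex k+1. Ptolemy first gives [lambda a i k.+2] = c + 1, then 1 on the new chord,
    then the counts at its ends. *)
Lemma lambda_glue a i k j c d :
  lambda a i k.+1 = 1 -> lambda a k.+1 j.+1 = 1 ->
  lambda a i k = d -> lambda a k.+2 j.+1 = c -> a k = d + c + 1 ->
  [/\ lambda a i j.+1 = 1,
      lambda a i.+1 j.+1 = lambda a i.+1 k.+1 + 1
    & lambda a i j = lambda a k.+1 j + 1].
Proof.
move=> ik kj dE cE ak.
have P1 := lambda_plucker a i k k.+1 k.+2.
have P2 := lambda_plucker a i k.+1 k.+2 j.+1.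
rewrite ik lambdaSS ak !lambdaS dE in P1; rewrite ik kj lambdaS cE in P2.
have ij : lambda a i j.+1 = 1 by lia.
have P3 := lambda_plucker a i i.+1 k.+1 j.+1.
have P4 := lambda_plucker a i k.+1 j j.+1.
by move: P3 P4; rewrite ik kj ij !lambdaS; split=> //; lia.
Qed.

(** Induction on y - x, cutting at the apex of the triangle below the arc. The counts at both ends
    are carried along because [lambda_glue] needs them at the apex. *)
Lemma arc_lambda n (T : {set {set 'I_n}}) (a : nat -> int) :
  triangulation T ->
  (forall x : 'I_n, a x = #|[set t in triangles T | x \in t]|%:Z) ->
  forall x y : 'I_n, (x < y)%N -> arc T x y ->
  [/\ lambda a x.+1 y.+1 = 1,
      lambda a x.+2 y.+1 = (triangles_between T x y x)%:Z
    & lambda a x.+1 y = (triangles_between T x y y)%:Z].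
Proof.
move=> trT aE; have ncT : noncrossing_diagonals T by case/maxsetP: trT.
suff H d (x y : 'I_n) : (y - x <= d)%N -> (x < y)%N -> arc T x y ->
  [/\ lambda a x.+1 y.+1 = 1,
      lambda a x.+2 y.+1 = (triangles_between T x y x)%:Z
    & lambda a x.+1 y = (triangles_between T x y y)%:Z].
  by move=> x y; apply: H (leqnn _).
elim: d x y => [|d IH] x y; first by lia.
move=> yxd xy axy; have [yE|yx] : y = x.+1 :> nat \/ (x.+1 < y)%N by lia.
  by rewrite !triangles_between_side // yE lambdaS !lambdaxx.
have [k [xk ky axk aky]] := arc_apex trT yx axy.
have [xk1 xk2 xk3] := IH x k ltac:(lia) xk axk.
have [ky1 ky2 ky3] := IH k y ltac:(lia) ky aky.
have split z := triangles_between_split z ncT xk ky axk aky axy.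
have out (u v z : 'I_n) : ~~ (u <= z <= v)%N -> triangles_between T u v z = 0%N.
  by move=> H; apply: triangles_between_out; rewrite inE.
(* All triangles at k lie below xy, so a_k is the sum of the counts in the two pieces plus one for
   the triangle x, k, y. *)
have [|->->->] := lambda_glue xk1 ky1 xk3 ky2 _.
  rewrite aE -(triangles_between_arc ncT xk ky axy) split !inE eqxx orbT /=.
  by rewrite !PoszD.
rewrite xk2 ky3 !split (out k y x) ?(out x k y); try lia.
by rewrite !inE !eqxx !orbT /= addn0 add0n !PoszD.
Qed.

(** Chords are unordered and [lambda] is antisymmetric, hence the absolute value; the ordinal x
    carries the label x+1. *)
Definition unit_diagonals n (a : nat -> int) : {set {set 'I_n}} :=
  [set e : {set 'I_n} | polygon_diagonal e &&
    [forall x in e, forall y in e, (x != y) ==> (`|lambda a x.+1 y.+1| == 1)]].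

(* By the Ptolemy relation, two crossing chords of value 1 would give
   1 = lambda_ac lambda_bd = lambda_ab lambda_cd + lambda_ad lambda_bc >= 2. *)
Lemma unit_diagonals_noncrossing n m : (3 <= n)%N -> finite_frieze n m ->
  noncrossing_diagonals (unit_diagonals n (quiddity m)).
Proof.
move=> n3 mF; apply/andP; split.
  by apply/forall_inP => e; rewrite inE => /andP[].
suff H e f : e \in unit_diagonals n (quiddity m) ->
    f \in unit_diagonals n (quiddity m) -> ~~ interleaved e f.
  apply/forall_inP => e eU; apply/forall_inP => f fU.
  by rewrite negb_or !H.
have unit e' x y : e' \in unit_diagonals n (quiddity m) -> e' = [set x; y] ->
    (x < y)%N -> `|lambda (quiddity m) x.+1 y.+1| = 1.
  rewrite inE => /andP[_ /forall_inP H] E xy.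
  have xe : x \in e' by rewrite E set21.
  have ye : y \in e' by rewrite E set22.
  have /forall_inP/(_ _ ye) := H _ xe.
  by rewrite -val_eqE /= neq_ltn xy => /eqP.
move=> eU fU; apply/existsP => -[x] /existsP[y] /existsP[z] /existsP[w].
case/and5P=> xy yz zw /eqP E /eqP F.
have xz1 := unit _ _ _ eU E (ltn_trans xy yz).
have yw1 := unit _ _ _ fU F (ltn_trans yz zw).
have pos (u v : 'I_n) : (u < v)%N -> 0 < lambda (quiddity m) u.+1 v.+1.
  by move=> uv; apply: (frieze_lambda_pos n3 mF); have := ltn_ord v; lia.
have := lambda_plucker (quiddity m) x.+1 y.+1 z.+1 w.+1.
rewrite gtr0_norm ?pos // in xz1; last by lia.
rewrite gtr0_norm ?pos // in yw1; last by lia.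
rewrite xz1 yw1; have := pos x y xy; have := pos z w zw; have := pos y z yz.
have := pos x w ltac:(lia); nia.
Qed.

(** As T is maximal and the unit diagonals do not cross, it is enough that every diagonal of T is
    one of them, which is [arc_lambda]. *)
Lemma triangulation_unit_diagonals n m (T : {set {set 'I_n}}) : (3 <= n)%N ->
  finite_frieze n m -> associated_triangulation m T ->
  T = unit_diagonals n (quiddity m).
Proof.
move=> n3 mF [trT aE]; have /maxsetP[ncT maxT] := trT.
apply/esym/maxT; first exact: unit_diagonals_noncrossing.
apply/subsetP => e eT; rewrite inE.
have /andP[/forall_inP/(_ _ eT) de _] := ncT; rewrite de /=.
have /andP[/cards2P[u [v [uv E]]] _] := de.
apply/forall_inP => x xe; apply/forall_inP => y ye; apply/implyP => xy.
have {}E : e = [set x; y].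
  move: xe ye xy; rewrite E !inE => /orP[] /eqP-> /orP[] /eqP->;
    rewrite ?eqxx // => _; by rewrite // setUC.
wlog xy1 : x y xe ye xy E / (x < y)%N.
  move=> H; have := ltngtP (x : nat) (y : nat).
  case=> [|lt|/val_inj xyE]; first exact: H.
    rewrite lambdaC normrN; apply: H => //; first by rewrite eq_sym.
    by rewrite E setUC.
  by rewrite xyE eqxx in xy.
have [|-> _ _] := @arc_lambda _ _ (quiddity m) trT aE x y xy1 _;
  last by rewrite normr1.
by rewrite /arc -E eT orbT.
Qed.

(** * Rotations of the polygon and periods of the frieze *)

(** The border rows of zeros and ones force the monodromy over n steps to be minus the identity. *)
Lemma frieze_lambda_antiperiod n m : (3 <= n)%N -> finite_frieze n m ->
  forall j k, lambda (quiddity m) (j + n) k = - lambda (quiddity m) j k.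
Proof.
move=> n3 mF; set a := quiddity m.
have ap := quiddity_period n3 (finite_frieze_period n3 mF).
have H x y l : hill a x y (l + n) = - hill a x y l.
  have Fn : hill a 0 1 n = 0.
    have := frieze_lambda n3 mF (leq0n n) (leqnn (0 + n)%N).
    rewrite -[X in _ = X -> _](_ : 0 = _).
      by rewrite /lambda /= !mul0r sub0r mulrN1 opprK.
    by rewrite -[LHS](frieze_zero_high mF 1); apply: frieze_eq; lia.
  have Gn : hill a (-1) 0 n = 1.
    have := @frieze_lambda n m n3 mF 1 n ltac:(lia) ltac:(lia).
    rewrite -[X in _ = X -> _](_ : 1 = _).
      by rewrite /lambda /= mul1r mulr0 subr0.
    by rewrite -[LHS](frieze_one_high mF 2); apply: frieze_eq; lia.
  have Gn1 : hill a (-1) 0 n.+1 = 0.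
    have := @frieze_lambda n m n3 mF 1 n.+1 ltac:(lia) ltac:(lia).
    rewrite -[X in _ = X -> _](_ : 0 = _).
      by rewrite /lambda /= mul1r mulr0 subr0.
    by rewrite -[LHS](frieze_zero_high mF 2); apply: frieze_eq; lia.
  (* This value would belong to an entry outside the band, so it is read off the determinant
     instead. *)
  have Fn1 : hill a 0 1 n.+1 = -1.
    have := lambdaS a n; rewrite /lambda Fn Gn mul0r mulr1; lia.
  rewrite hill_add (eq_hill _ _ _ ap) hill_linear.
  rewrite [hill a x y n]hill_linear [hill a x y n.+1]hill_linear.
  by rewrite [hill a x y l]hill_linear Fn Gn Gn1 Fn1; ring.
by move=> j k; rewrite /lambda !H; ring.
Qed.

Lemma frieze_lambda_modn n m : (3 <= n)%N -> finite_frieze n m ->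
  forall j k, `|lambda (quiddity m) (j %% n).+1 (k %% n).+1| =
              `|lambda (quiddity m) j.+1 k.+1|.
Proof.
move=> n3 mF.
have H c j k :
    `|lambda (quiddity m) (j + c * n) k| = `|lambda (quiddity m) j k|.
  elim: c => [|c IH]; first by rewrite mul0n addn0.
  by rewrite mulSnr addnA (frieze_lambda_antiperiod n3 mF) normrN.
have Hm j k :
    `|lambda (quiddity m) (j %% n).+1 k| = `|lambda (quiddity m) j.+1 k|.
  by rewrite [in RHS](divn_eq j n) addnC -addSn H.
by move=> j k; rewrite Hm lambdaC normrN Hm lambdaC normrN.
Qed.

Lemma iter_ordS_val n k (x : 'I_n) :
  iter k (@ordS n) x = ((x + k) %% n)%N :> nat.
Proof.
elim: k => [|k IH]; first by rewrite addn0 modn_small.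
by rewrite iterS /= IH addnS -addn1 modnDml addn1.
Qed.

Lemma iter_ordS_inj n k : injective (iter k (@ordS n)).
Proof. by elim: k => [|k IH] x y //=; move/ordS_inj/IH. Qed.

Lemma rotate_chord_inj n k : injective (@rotate_chord n k).
Proof. exact: imset_inj (@iter_ordS_inj n k). Qed.

Lemma rotate_chord_surj n k (e : {set 'I_n}) : exists f, e = rotate_chord k f.
Proof.
have [g gK Kg] := injF_bij (@iter_ordS_inj n k).
exists [set g x | x in e]; rewrite /rotate_chord -imset_comp.
by rewrite (eq_imset (g := id)) ?imset_id.
Qed.

Lemma card_rotate_chord n k (e : {set 'I_n}) : #|rotate_chord k e| = #|e|.
Proof. exact: card_imset (@iter_ordS_inj n k). Qed.

Lemma rotate_chord_side n k (e : {set 'I_n}) :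
  polygon_side (rotate_chord k e) = polygon_side e.
Proof.
have E x : rotate_chord k [set x; ordS x] =
    [set iter k (@ordS n) x; ordS (iter k (@ordS n) x)].
  by rewrite /rotate_chord imsetU1 imset_set1 -iterSr.
apply/existsP/existsP => -[x /eqP]; last first.
  by move=> ->; exists (iter k (@ordS n) x); rewrite E.
have [g gK Kg] := injF_bij (@iter_ordS_inj n k).
by rewrite -{1 2}(Kg x) -E => /rotate_chord_inj ->; exists (g x).
Qed.

Lemma rotate_chord_sub n k (e f : {set 'I_n}) :
  (rotate_chord k e \subset rotate_chord k f) = (e \subset f).
Proof.
apply/idP/idP => [/subsetP H|]; last exact: imsetS.
apply/subsetP => x xe; rewrite -(mem_imset _ _ (@iter_ordS_inj n k)).
by apply: H; rewrite (mem_imset _ _ (@iter_ordS_inj n k)).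
Qed.

Lemma rotate_triangles n (T : {set {set 'I_n}}) k (t : {set 'I_n}) :
  [set rotate_chord k e | e in T] = T ->
  (rotate_chord k t \in triangles T) = (t \in triangles T).
Proof.
move=> kT; rewrite !inE card_rotate_chord; congr (_ && _).
have E e : (rotate_chord k e \subset rotate_chord k t) &&
      (#|rotate_chord k e| == 2)
      ==> polygon_side (rotate_chord k e) || (rotate_chord k e \in T) =
   ((e \subset t) && (#|e| == 2) ==> polygon_side e || (e \in T)).
  rewrite rotate_chord_sub card_rotate_chord rotate_chord_side -{1}kT.
  by rewrite (mem_imset _ _ (@rotate_chord_inj n k)).
apply/forallP/forallP => H e; first by rewrite -E.
by have [f ->] := rotate_chord_surj k e; rewrite E.
Qed.

(** A rotation preserving T permutes its triangles, hence preserves the quiddity, and the quiddity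
    determines every row of the frieze. *)
Lemma rotation_period n m (T : {set {set 'I_n}}) k : (3 <= n)%N ->
  finite_frieze n m -> associated_triangulation m T ->
  [set rotate_chord k e | e in T] = T -> frieze_period n m k.
Proof.
move=> n3 mF [_ aE] kT.
have mn := finite_frieze_period n3 mF.
have amod x : quiddity m (x %% n) = quiddity m x.
  rewrite [in RHS](divn_eq x n) addnC.
  by rewrite (quiddity_period n3 (period_muln _ mn)).
have rot (x : 'I_n) : quiddity m (x + k) = quiddity m x.
  rewrite -[LHS]amod -iter_ordS_val /quiddity !aE; congr Posz.
  rewrite -[RHS](card_imset _ (@rotate_chord_inj n k)); apply: eq_card => t.
  have [f ->] := rotate_chord_surj k t.
  rewrite (mem_imset _ _ (@rotate_chord_inj n k)) in_set [RHS]in_set.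
  by rewrite rotate_triangles // (mem_imset _ _ (@iter_ordS_inj n k)).
have ak x : quiddity m (x + k) = quiddity m x.
  have xn : (x %% n < n)%N by rewrite ltn_mod; lia.
  by rewrite -amod -modnDml amod (rot (Ordinal xn)) amod.
move=> i j ij; have ij' := ij; rewrite /in_band in ij'.
(* Translating by c n makes the row index positive, where [quiddity] is defined. *)
pose c := (absz i).+1; have mc := period_muln c mn.
have [l lE] : exists l : nat, i + (c * n)%N%:Z = l.+1%:Z.
  by exists (absz (i + (c * n)%N%:Z - 1)%R); nia.
have [d dE] : exists d : nat, j - i + 2 = d%:Z
  by exists (absz (j - i + 2)%R); lia.
rewrite -[RHS](mc _ _ ij) -(mc (i + k%:Z)); last by rewrite /in_band; lia.
have -> : j + (c * n)%N%:Z = l.+1%:Z - 2 + d%:Z by lia.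
have -> : j + k%:Z + (c * n)%N%:Z = (l + k).+1%:Z - 2 + d%:Z by lia.
have -> : i + k%:Z + (c * n)%N%:Z = (l + k).+1%:Z by lia.
rewrite lE !(frieze_row n3 mF); try lia.
apply: eq_hill => u; have := ak (l + u)%N; rewrite /quiddity.
have -> : (l + u + k).+1%:Z = (l + k).+1%:Z + u%:Z by lia.
by have -> : (l + u).+1%:Z = l.+1%:Z + u%:Z by lia.
Qed.

Lemma period_rotation n m k : (3 <= n)%N ->
  finite_frieze n m -> frieze_period n m k ->
  [set rotate_chord k e | e in unit_diagonals n (quiddity m)] =
  unit_diagonals n (quiddity m).
Proof.
move=> n3 mF mk; apply/eqP.
(* Rotation is injective on chords, so one inclusion is enough. *)
rewrite eqEcard (card_imset _ (@rotate_chord_inj n k)) leqnn andbT.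
apply/subsetP => _ /imsetP[e + ->]; rewrite !inE.
move=> /andP[/andP[e2 es] /forall_inP H].
rewrite /polygon_diagonal card_rotate_chord rotate_chord_side e2 es /=.
apply/forall_inP => _ /imsetP[x xe ->]; apply/forall_inP => _ /imsetP[y ye ->].
rewrite (inj_eq (@iter_ordS_inj n k)) !iter_ordS_val (frieze_lambda_modn n3 mF).
rewrite -!addSn (lambda_period _ _ (quiddity_period n3 mk)).
by have /forall_inP/(_ _ ye) := H _ xe.
Qed.

(** * The order of symmetry and the conclusion *)

Lemma card_dvd_ord n p : (p %| n)%N ->
  #|[set k : 'I_n | (p %| k)%N]| = (n %/ p)%N.
Proof.
move=> pn; rewrite divn_count_dvd -sum1_card big_mkcond /=.
under eq_bigr => k _ do rewrite inE.
rewrite -(big_mkord xpredT (fun k => if (p %| k)%N then 1%N else 0%N)).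
case: n pn => [|n] pn; first by rewrite !big_geq.
by rewrite big_ltn // dvdn0 [RHS]big_nat_recr //= pn addnC; congr (_ + _)%N.
Qed.

(** The rotations preserving T are the periods k < n, including 0, and these are the multiples of
    p. *)
Lemma symmetry_order n m p (T : {set {set 'I_n}}) : (3 <= n)%N ->
  finite_frieze n m -> associated_triangulation m T -> minimal_period n m p ->
  rotational_symmetry_order T = (n %/ p)%N.
Proof.
move=> n3 mF mT pP.
rewrite -(card_dvd_ord (minimal_period_dvd pP (finite_frieze_period n3 mF))).
apply: eq_card => k; rewrite !inE; apply/eqP/idP => [|/dvdnP[c kE]].
  by move/(rotation_period n3 mF mT); apply: minimal_period_dvd.
rewrite (triangulation_unit_diagonals n3 mF mT) period_rotation // kE.
by case: pP => _ mp _; apply: period_muln.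
Qed.

Theorem proposition4p1 :
  (forall (n : nat) (m : int -> int -> int) (s : int),
      (3 <= n)%N -> finite_frieze n m ->
      principal_growth_coefficient n m s ->
      [\/ s = - 2, s = 0 | s = 1]) /\
  (forall (n n' : nat) (m m' : int -> int -> int)
      (T : {set {set 'I_n}}) (T' : {set {set 'I_n'}}) (s s' : int),
      (3 <= n)%N -> (3 <= n')%N ->
      finite_frieze n m -> finite_frieze n' m' ->
      associated_triangulation m T -> associated_triangulation m' T' ->
      principal_growth_coefficient n m s ->
      principal_growth_coefficient n' m' s' ->
      rotational_symmetry_order T = rotational_symmetry_order T' ->
      s = s').
Proof.
split=> [n m s n3 mF [M [p [MF pP ->]]]|].
  by case: (growth_by_symmetry n3 mF pP MF) => -[_ ->];
    [constructor 1 | constructor 2 | constructor 3].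
move=> n n' m m' T T' s s' n3 n3' mF mF' mT mT'.
move=> [M [p [MF pP ->]]] [M' [p' [MF' pP' ->]]].
rewrite (symmetry_order n3 mF mT pP) (symmetry_order n3' mF' mT' pP').
have [[p1 _ _] [p1' _ _]] := (pP, pP').
case: (growth_by_symmetry n3 mF pP MF) => -[-> ->];
case: (growth_by_symmetry n3' mF' pP' MF') => -[-> ->] //.
(* In the remaining cases the two orders are distinct elements of 1, 2, 3, against the
   hypothesis. *)
all: by rewrite ?mulnK ?divnn ?p1 ?p1'.
Qed.
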